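(* Let $f:\mathcal{X}\to\mathbb{R}$ be convex and differentiable with $L_f$-Lipschitz gradient and with a minimizer $x^*$, $f^*=f(x^* )$. Consider the approximate accelerated mirror descent (AMD) iterations $x^{(k)},\tilde z^{(k)},\tilde x^{(k)}$ defined in the context, with parameter $r\ge 3$, step-sizes $(t_k)_{k=0}^\infty$ and forward mirror potential $\psi=M_\theta$, and let $\hat z^{(k)}$ be the exact mirror descent iterates defined in the context. Assume that: (i) $\psi^*$ is $L_{\psi^*}$-smooth with respect to $\|\cdot\|_*$, i.e. $B_{\psi^*}(z,y)\le \frac{L_{\psi^*}}{2}\|z-y\|_*^2$ for all $z,y$ (equivalently, $\nabla\psi^*$ is $L_{\psi^*}$-Lipschitz); (ii) there exist $0<\ell_R\le L_R$ such that $\frac{\ell_R}{2}\|x-x'\|^2\le R(x,x')\le\frac{L_R}{2}\|x-x'\|^2$ for all $x,x'\in\mathcal{X}$; (iii) $\gamma\ge L_R L_{\psi^*}$ and $t_k\le \frac{\ell_R}{L_f\gamma}$ for all $k$; (iv) the step-sizes $(t_k)_{k=0}^\infty$ are non-increasing; (v) the approximation error term $$\left\langle \nabla\psi(\tilde z^{(k+1)})-\nabla\psi(\hat z^{(k+1)}),\ \tilde z^{(k+1)}-x^*\right\rangle$$ is uniformly bounded over $k\ge 0$ by a constant $M>0$. If the step-sizes are chosen as $t_k=\Theta(k^{-c})$ for some $c\in[0,1)$, then $f(\tilde x^{(k)})-f^*=\mathcal{O}(k^{c-1})$ as $k\to\infty$.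
   Context: $\mathcal{X}=(\mathbb{R}^n,\|\cdot\|)$ is a finite-dimensional normed space with dual $\mathcal{X}^*=((\mathbb{R}^n)^*,\|\cdot\|_* )$, where $\|p\|_*=\sup\{\langle p,x\rangle:\|x\|\le1\}$ and $\langle p,x\rangle=p(x)$. For a differentiable convex $h$, the Bregman divergence is $B_h(x,y)=h(x)-h(y)-\langle h'(y),x-y\rangle$. A mirror potential is an $\alpha$-strongly convex ($\alpha>0$) $\mathcal{C}^1$ function $\psi:\mathcal{X}\to\mathbb{R}$; its convex conjugate is $\psi^*:\mathcal{X}^*\to\mathbb{R}$, and $\nabla\psi^*=(\nabla\psi)^{-1}$. $M_\theta:\mathcal{X}\to\mathbb{R}$ is a mirror potential, denoted $\psi=M_\theta$, and $M_\vartheta^*:\mathcal{X}^*\to\mathbb{R}$ is a differentiable function (not necessarily the convex conjugate of $M_\theta$), so that $\nabla M_\vartheta^*$ is only an approximation of $(\nabla M_\theta)^{-1}$. Approximate AMD iterations: given $\tilde x^{(0)}=\tilde z^{(0)}=x^{(0)}\in\mathcal{X}$, step-sizes $t_k>0$, a parameter $r\ge3$, a parameter $\gamma>0$ and a regularization function $R:\mathcal{X}\times\mathcal{X}\to\mathbb{R}$, for $k=0,1,2,\dots$: - $x^{(k+1)}=\lambda_k\tilde z^{(k)}+(1-\lambda_k)\tilde x^{(k)}$ with $\lambda_k=\frac{r}{r+k}$; - $\tilde z^{(k+1)}=\nabla M_\vartheta^*\left(\nabla M_\theta(\tilde z^{(k)})-\frac{kt_k}{r}\nabla f(x^{(k+1)})\right)$;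 - $\tilde x^{(k+1)}\in\operatorname{argmin}_{\tilde x\in\mathbb{R}^n}\ \gamma t_k\langle\nabla f(x^{(k+1)}),\tilde x\rangle+R(\tilde x,x^{(k+1)})$. Exact mirror descent iterates: $\hat z^{(k+1)}=(\nabla M_\theta)^{-1}\left(\nabla M_\theta(\tilde z^{(k)})-\frac{kt_k}{r}\nabla f(x^{(k+1)})\right)$. *)

(* Defs.v *)
From mathcomp Require Import all_boot all_order all_algebra.
From mathcomp Require Import all_classical all_reals all_analysis.

Set Implicit Arguments.
Unset Strict Implicit.
Unset Printing Implicit Defensive.

Import Order.TTheory GRing.Theory Num.Theory.
Import numFieldNormedType.Exports.

Local Open Scope classical_set_scope.
Local Open Scope ring_scope.

(* R^n is 'rV[R]_n and its dual (R^n)^* is 'cV[R]_n, a linear form acting on a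
   row vector by right multiplication.  The norm of the space is an arbitrary
   function N on 'rV[R]_n satisfying [is_norm]; the canonical (max) norm of
   'rV[R]_n and 'cV[R]_n only provides the topology used by [differentiable],
   ['d] and [continuous], which in finite dimension does not depend on the
   norm. *)

Definition is_norm (R : realType) (V : lmodType R) (N : V -> R) : Prop :=
  [/\ forall x, N x = 0 -> x = 0,
      forall (a : R) x, N (a *: x) = `|a| * N x &
      forall x y, N (x + y) <= N x + N y].

Definition pairing (R : realType) (n : nat) (p : 'cV[R]_n) (x : 'rV[R]_n) : R :=
  (x *m p) 0 0.

Definition dual_norm (R : realType) (n : nat) (N : 'rV[R]_n -> R)
    (p : 'cV[R]_n) : R :=
  sup [set pairing p x | x in [set x | N x <= 1]].

(* The transposed shape makes the gradient of a function on 'rV[R]_n an element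
   of the dual 'cV[R]_n, and the gradient of a function on the dual 'cV[R]_n an
   element of the bidual 'rV[R]_n. *)
Definition grad (R : realType) (m n : nat) (h : 'M[R]_(m, n) -> R)
    (x : 'M[R]_(m, n)) : 'M[R]_(n, m) :=
  \matrix_(i, j) 'd h x (delta_mx j i).

Definition bregman (R : realType) (V : normedModType R) (h : V -> R)
    (x y : V) : R :=
  h x - h y - 'd h y (x - y).

Definition strongly_convex (R : realType) (V : lmodType R) (N : V -> R)
    (alpha : R) (h : V -> R) : Prop :=
  forall (x y : V) (s : R), 0 <= s <= 1 ->
    h (s *: x + (1 - s) *: y) <=
      s * h x + (1 - s) * h y - alpha / 2 * (s * (1 - s)) * N (x - y) ^+ 2.

Definition mirror_potential (R : realType) (n : nat) (N : 'rV[R]_n -> R)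
    (alpha : R) (psi : 'rV[R]_n -> R) : Prop :=
  [/\ 0 < alpha,
      strongly_convex N alpha psi,
      forall x, differentiable psi x &
      continuous (grad psi)].

(* The supremum is finite when psi is a mirror potential. *)
Definition conjugate (R : realType) (n : nat) (psi : 'rV[R]_n -> R)
    (p : 'cV[R]_n) : R :=
  sup [set pairing p x - psi x | x in [set: 'rV[R]_n]].

(* The inverse of x |-> grad psi x, which is a bijection when psi is a mirror
   potential; 0 is the dummy value outside its range. *)
Definition grad_inv (R : realType) (n : nat) (psi : 'rV[R]_n -> R) :
    'cV[R]_n -> 'rV[R]_n :=
  'pinv_(fun=> 0) [set: 'rV[R]_n] (grad psi).

Definition argmin (R : realType) (T : Type) (F : T -> R) : set T :=
  [set u | forall v, F u <= F v].

(* grad Mth (z k) - (k t_k / r) grad f (x (k+1)) *)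
Definition dual_step (R : realType) (n : nat) (f Mth : 'rV[R]_n -> R)
    (r : R) (t : nat -> R) (x z : nat -> 'rV[R]_n) (k : nat) : 'cV[R]_n :=
  grad Mth (z k) - (k%:R * t k / r) *: grad f (x k.+1).

Definition approx_amd (R : realType) (n : nat) (f Mth : 'rV[R]_n -> R)
    (Mstar : 'cV[R]_n -> R) (Reg : 'rV[R]_n -> 'rV[R]_n -> R)
    (r gamma : R) (t : nat -> R) (x xt zt : nat -> 'rV[R]_n) : Prop :=
  [/\ xt 0%N = x 0%N,
      zt 0%N = x 0%N,
      forall k, let lam := r / (r + k%:R) in
        x k.+1 = lam *: zt k + (1 - lam) *: xt k,
      forall k, zt k.+1 = grad Mstar (dual_step f Mth r t x zt k) &
      forall k, argmin (fun u =>
          gamma * t k * pairing (grad f (x k.+1)) u + Reg u (x k.+1))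
        (xt k.+1)].

(* The exact iterates zh (k+1) restart at every k from the approximate iterate
   zt k; zh 0 is not constrained. *)
Definition exact_md (R : realType) (n : nat) (f Mth : 'rV[R]_n -> R)
    (r : R) (t : nat -> R) (x zt zh : nat -> 'rV[R]_n) : Prop :=
  forall k, zh k.+1 = grad_inv Mth (dual_step f Mth r t x zt k).

(* Main.v *)
Require Import Defs.
From HB Require Import structures.
From mathcomp Require Import all_boot all_order all_algebra.
From mathcomp Require Import all_classical all_reals all_analysis.
From mathcomp Require Import ring lra.
Import Order.TTheory GRing.Theory Num.Theory.
Import numFieldNormedType.Exports.
Local Open Scope classical_set_scope.
Local Open Scope ring_scope.

(** The proof is a Lyapunov argument. Write F_k = f (xt k) - f xstar, let D_k be
the Bregman divergence of psi from xstar to zt k, and put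
E_k = D_k + (k^2 t_k / r^2) F_k. The claim is that E_(k+1) <= E_k + M for k >= 1.
Hence E_k <= E_1 + (k - 1) M, and since D_k >= 0 this gives F_k = O(1 / (k t_k)),
which is O(k^(c - 1)) when t_k is at least a multiple of k^(-c).

For the step, let g be the gradient of f at x (k+1) and a = k t_k / r. The
three-point identity for Bregman divergences shows that replacing zt k by the
exact iterate zh (k+1), and then zh (k+1) by zt (k+1), changes D_k by at most
- a <g, zt k - xstar> + (Lpsi / 2) a^2 |g|_*^2 + M [mirror_step]: the quadratic
term comes from smoothness of psi^*, the constant M from the approximation error.
The minimization defining xt (k+1) compensates the quadratic term, as it lowers f
by at least gamma t_k / (2 LR) |g|_*^2 >= (Lpsi / 2) t_k |g|_*^2
[regularized_step]. Since x (k+1) is a convex combination of zt k and xt k, the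
linear term is controlled by convexity of f at x (k+1), which leaves
F_(k+1) with weight k (k + r) t_k / r^2 [amd_energy_step]. That weight dominates
(k + 1)^2 t_(k+1) / r^2 for k >= 1, because r >= 3 and t is non-increasing.

Two facts about a mirror potential are used: its gradient is onto, so that
grad_inv is a right inverse of it [grad_invK], and its conjugate is
differentiable at each grad psi y with gradient y [diff_conjugate]. Both follow
from strong convexity, once the given norm has been compared with the max norm
that defines the topology [is_norm_lower]. *)

(** * The dual pairing and arbitrary norms on row vectors *)

Lemma pairingDl {R : realType} {n} (p q : 'cV[R]_n) x :
  pairing (p + q) x = pairing p x + pairing q x.
Proof. by rewrite /pairing mulmxDr mxE. Qed.

Lemma pairingDr {R : realType} {n} (p : 'cV[R]_n) x y :
  pairing p (x + y) = pairing p x + pairing p y.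
Proof. by rewrite /pairing mulmxDl mxE. Qed.

Lemma pairingZl {R : realType} {n} a (p : 'cV[R]_n) x :
  pairing (a *: p) x = a * pairing p x.
Proof. by rewrite /pairing -scalemxAr mxE. Qed.

Lemma pairingZr {R : realType} {n} a (p : 'cV[R]_n) x :
  pairing p (a *: x) = a * pairing p x.
Proof. by rewrite /pairing -scalemxAl mxE. Qed.

Lemma pairingBl {R : realType} {n} (p q : 'cV[R]_n) x :
  pairing (p - q) x = pairing p x - pairing q x.
Proof. by rewrite -scaleN1r pairingDl pairingZl mulN1r. Qed.

Lemma pairingBr {R : realType} {n} (p : 'cV[R]_n) x y :
  pairing p (x - y) = pairing p x - pairing p y.
Proof. by rewrite -scaleN1r pairingDr pairingZr mulN1r. Qed.

Lemma pairing0r {R : realType} {n} (p : 'cV[R]_n) : pairing p 0 = 0.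
Proof. by rewrite -(scale0r 0) pairingZr mul0r. Qed.

Lemma pairing_delta {R : realType} {n} (p : 'cV[R]_n) i :
  pairing p (delta_mx 0 i) = p i 0.
Proof. by rewrite /pairing -rowE mxE. Qed.

Lemma diff_pairing {R : realType} {n} (h : 'rV[R]_n -> R) x v :
  'd h x v = pairing (grad h x) v.
Proof.
rewrite {1}[v]row_sum_delta linear_sum /pairing mxE.
by apply: eq_bigr => j _; rewrite linearZ mxE.
Qed.

Lemma ler_coord_norm {R : realType} {m n} (A : 'M[R]_(m, n)) i j :
  `|A i j| <= `|A|.
Proof.
rewrite -[`|A|]/(mx_norm A) mx_normrE.
exact: (le_bigmax _ (fun ij : 'I_m * 'I_n => `|A ij.1 ij.2|) (i, j)).
Qed.

Lemma ler_pairing_norm {R : realType} {n} (p : 'cV[R]_n) x :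
  `|pairing p x| <= n%:R * `|p| * `|x|.
Proof.
rewrite /pairing mxE; apply: le_trans (ler_norm_sum _ _ _) _.
apply: (@le_trans _ _ (\sum_(j < n) `|p| * `|x|)); last first.
  by rewrite sumr_const card_ord -mulrA mulr_natl.
apply: ler_sum => j _; rewrite normrM mulrC.
by apply: ler_pM => //; exact: ler_coord_norm.
Qed.

Lemma is_norm_ge0 {R : realType} {V : lmodType R} (N : V -> R) :
  is_norm N -> forall x, 0 <= N x.
Proof.
move=> [_ NZ ND] x; have := ND x (- x).
rewrite subrr -scaleN1r NZ normrN1 mul1r.
rewrite -[X in N X](scale0r (0 : V)) NZ normr0 mul0r; lra.
Qed.

Lemma is_norm0 {R : realType} {V : lmodType R} (N : V -> R) :
  is_norm N -> N 0 = 0.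
Proof. by move=> [_ NZ _]; rewrite -(scale0r 0) NZ normr0 mul0r. Qed.

Lemma is_norm_upper {R : realType} {n} (N : 'rV[R]_n -> R) : is_norm N ->
  exists2 K, 0 <= K & forall x, N x <= K * `|x|.
Proof.
move=> NN; have [_ NZ ND] := NN.
exists (\sum_(j < n) N (delta_mx 0 j)).
  by apply: sumr_ge0 => j _; exact: is_norm_ge0.
move=> x; rewrite {1}[x]row_sum_delta.
apply: (@le_trans _ _ (\sum_(j < n) N (x 0 j *: delta_mx 0 j))).
  elim/big_ind2 : _ => //; first by rewrite (is_norm0 _ NN).
  by move=> a b c d ab cd; apply: le_trans (ND _ _) (lerD ab cd).
rewrite mulr_suml; apply: ler_sum => j _; rewrite NZ mulrC.
by apply: ler_wpM2l; [exact: is_norm_ge0|exact: ler_coord_norm].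
Qed.

Lemma lipschitz_real_continuous {R : realType} {V : normedModType R}
    (h : V -> R) K :
  (forall x y, h x - h y <= K * `|x - y|) -> continuous h.
Proof.
move=> hK x; apply/(@cvgrPdist_le R R^o _ (nbhs x) _ h (h x)) => e e0; near=> y.
have xy : `|K| * `|x - y| <= e.
  apply: (@le_trans _ _ ((`|K| + 1) * `|x - y|)).
    by rewrite ler_wpM2r// lerDl.
  rewrite -ler_pdivlMl ?ltr_wpDl//.
  near: y; apply: (@pseudometric_normed_Zmodule.cvgr_dist_le R V _ (nbhs x) _ id x) => //.
  by rewrite mulr_gt0// invr_gt0 ltr_wpDl.
have KK (u : V) : K * `|u| <= `|K| * `|u| by rewrite ler_wpM2r// ler_norm.
have := le_trans (hK y x) (KK _); have := le_trans (hK x y) (KK _).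
rewrite [`|y - x|]distrC ler_norml => ? ?; apply/andP; split; lra.
Unshelve. all: by end_near. Qed.

Lemma is_norm_continuous {R : realType} {n} (N : 'rV[R]_n -> R) : is_norm N ->
  continuous N.
Proof.
move=> NN; have [K K0 NK] := is_norm_upper N NN; have [_ _ ND] := NN.
apply: (@lipschitz_real_continuous _ _ _ K) => x y.
rewrite lerBlDr; have := ND (x - y) y; rewrite subrK => /le_trans; apply.
by rewrite lerD2r.
Qed.

(** The minimum of [N] over the compact unit sphere of the max norm is positive,
so [N] dominates the max norm. *)
Lemma is_norm_lower {R : realType} {n} (N : 'rV[R]_n -> R) : is_norm N ->
  exists2 K, 0 < K & forall x, `|x| <= K * N x.
Proof.
move=> NN; have [N0 NZ _] := NN.
pose S := [set x : 'rV[R]_n | `|x| = 1].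
(* The sphere is empty when n = 0. *)
have [S0|] := pselect (S !=set0); last first.
  move=> SN; exists 1 => // x; rewrite mul1r.
  have [->|x0] := eqVneq x 0; first by rewrite normr0 is_norm_ge0.
  exfalso; apply: SN; exists (`|x|^-1 *: x) => /=.
  by rewrite /S/= normrZ normfV normr_id mulVf// normr_eq0.
have cS : compact S.
  apply: bounded_closed_compact.
    by exists 1; split=> // M M1 x /= ->; exact: ltW.
  apply: (@closed_comp _ _ (fun x : 'rV[R]_n => `|x|) [set 1]).
    by move=> x _; exact: norm_continuous.
  exact: closed_eq.
have [|c] := EVT_min_rV S0 cS (f := N).
  by apply: continuous_subspaceT; exact: is_norm_continuous.
rewrite inE /S/= => c1 cmin.
have Nc : 0 < N c.
  rewrite lt_neqAle is_norm_ge0// andbT eq_sym; apply/eqP => /N0 c0.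
  by move: c1; rewrite c0 normr0 => /esym/eqP; rewrite oner_eq0.
exists (N c)^-1; rewrite ?invr_gt0// => x; rewrite ler_pdivlMl//.
have [->|x0] := eqVneq x 0; first by rewrite normr0 mulr0 is_norm_ge0.
have x1 : 0 < `|x| by rewrite normr_gt0.
rewrite -ler_pdivlMr//; have := cmin (`|x|^-1 *: x).
rewrite NZ normfV normr_id mulrC; apply.
by rewrite inE /S/= normrZ normfV normr_id mulVf// gt_eqF.
Qed.

Lemma ler_pairing_is_norm {R : realType} {n} (N : 'rV[R]_n -> R) :
  is_norm N -> exists2 K, 0 <= K & forall p x, `|pairing p x| <= K * `|p| * N x.
Proof.
move=> NN; have [K K0 KN] := is_norm_lower N NN.
exists (n%:R * K) => [|p x]; first by rewrite mulr_ge0// ltW.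
apply: le_trans (ler_pairing_norm _ _) _.
by rewrite -!mulrA ler_wpM2l// mulrCA ler_wpM2l.
Qed.

(** The set whose supremum defines [dual_norm] is bounded, because [N] dominates
the max norm; hence the duality inequality holds for every linear form. *)
Lemma ler_pairing_dual {R : realType} {n} (N : 'rV[R]_n -> R) : is_norm N ->
  forall p x, pairing p x <= dual_norm N p * N x.
Proof.
move=> NN p x; have [N0 NZ _] := NN.
have [x0|Nx0] := eqVneq (N x) 0.
  by rewrite x0 (N0 _ x0) pairing0r mulr0.
have Nx : 0 < N x by rewrite lt_neqAle eq_sym Nx0 is_norm_ge0.
rewrite -ler_pdivrMr//; apply: ub_le_sup.
  have [K K0 KN] := ler_pairing_is_norm N NN.
  exists (K * `|p|) => _ [y /= y1 <-].
  apply: le_trans (ler_norm _) _; apply: le_trans (KN _ _) _.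
  by rewrite ler_piMr// mulr_ge0.
exists ((N x)^-1 *: x) => /=; last by rewrite pairingZr mulrC.
by rewrite NZ gtr0_norm ?invr_gt0// mulVf.
Qed.

Lemma dual_norm_le {R : realType} {n} (N : 'rV[R]_n -> R) : is_norm N ->
  forall p a, (forall x, N x <= 1 -> pairing p x <= a) -> dual_norm N p <= a.
Proof.
move=> NN p a pa; apply: ge_sup; last by move=> _ [x /= x1 <-]; exact: pa.
by exists 0, 0 => /=; rewrite ?pairing0r ?(is_norm0 _ NN).
Qed.

Lemma dual_norm_ge0 {R : realType} {n} (N : 'rV[R]_n -> R) : is_norm N ->
  forall p, 0 <= dual_norm N p.
Proof.
move=> NN p; apply: ub_le_sup.
  have [K K0 KN] := ler_pairing_is_norm N NN.
  exists (K * `|p|) => _ [y /= y1 <-].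
  apply: le_trans (ler_norm _) _; apply: le_trans (KN _ _) _.
  by rewrite ler_piMr// mulr_ge0.
by exists 0 => /=; rewrite ?pairing0r ?(is_norm0 _ NN).
Qed.

(** * First-order inequalities for convex, strongly convex and smooth functions *)

(** A quadratic upper bound along a half-line bounds the directional derivative
at its origin. *)
Lemma diff_le_of_line {R : realType} {V : normedModType R} (h : V -> R) y v A B :
  differentiable h y ->
  (forall s, 0 < s <= 1 -> h (y + s *: v) <= h y + s * A + s ^+ 2 * B) ->
  'd h y v <= A.
Proof.
move=> dh hle; rewrite -deriveE//.
have cv : (fun s : R => s^-1 *: ((h \o shift y) (s *: v) - h y)) @ 0^' -->
    'D_v h y.
  exact: (@diff_derivable _ _ _ h y v dh).
have lA : (fun s : R => A + s * B) @ 0^'+ --> A.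
  rewrite -[X in _ --> X]addr0 -[X in _ --> _ + X](mul0r B).
  apply: (@cvg_at_right_filter R R^o); apply: (@cvgD R R^o _ _ _ (fun=> A)).
    exact: cvg_cst.
  exact: mulrr_continuous.
apply: ler_cvg_to (cvg_dnbhs_at_right cv) lA _.
near=> s.
have s0 : 0 < s by near: s; exact: nbhs_right_gt.
have s1 : s <= 1 by near: s; apply: nbhs_right_le.
have := hle s; rewrite s0 s1 => /(_ isT) /= hs.
rewrite /= [s *: v + y]addrC [_ *: (_ : R)]/(_ * _) ler_pdivrMl//; lra.
Unshelve. all: by end_near. Qed.

Lemma is_derive_line {R : realType} {V : normedModType R} (h : V -> R) x v s :
  differentiable h (x + s *: v) ->
  is_derive s 1 (fun s : R => h (x + s *: v)) ('d h (x + s *: v) v).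
Proof.
move=> dh.
have dl : is_diff s (fun s : R => x + s *: v) (fun s : R => s *: v).
  have := is_diffD (is_diff_cst x s) (is_diff_scalel s v).
  by rewrite add0r.
have dc := is_diff_comp dl (differentiableP dh).
have dd : differentiable (fun s : R => h (x + s *: v)) s by case: dc.
apply: DeriveDef; first exact: diff_derivable.
by rewrite deriveE//; case: dc => _ /= ->; rewrite /= scale1r.
Qed.

Lemma diff_ge_of_line {R : realType} {V : normedModType R} (h : V -> R) y v A B :
  differentiable h y ->
  (forall s, 0 < s <= 1 -> h y + s * A - s ^+ 2 * B <= h (y + s *: v)) ->
  A <= 'd h y v.
Proof.
move=> dh hle.
have dN := differentiableN dh.
have := @diff_le_of_line _ _ (- h) y v (- A) B dN.
rewrite diffN// => /= H; rewrite -lerN2; apply: H => s /hle.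
rewrite !fctE; lra.
Qed.

(** First-order form of strong convexity: the defining inequality on the segment
from [y] to [x] is an upper bound for [diff_le_of_line]. *)
Lemma strongly_convex_diff {R : realType} {n} (N : 'rV[R]_n -> R) alpha h :
  (forall x, differentiable h x) -> strongly_convex N alpha h ->
  forall x y, h y + pairing (grad h y) (x - y) + alpha / 2 * N (x - y) ^+ 2 <= h x.
Proof.
move=> dh ch x y; rewrite -diff_pairing.
have : 'd h y (x - y) <= h x - h y - alpha / 2 * N (x - y) ^+ 2.
  apply: (@diff_le_of_line _ _ _ _ _ _ (alpha / 2 * N (x - y) ^+ 2)) => // s s01.
  have /ch : 0 <= s <= 1 by case/andP: s01 => /ltW -> ->.
  move=> /(_ x y).
  have -> : s *: x + (1 - s) *: y = y + s *: (x - y).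
    by rewrite scalerBl scale1r scalerBr addrCA addrC -addrA [- _ + _]addrC addrA.
  nra.
lra.
Qed.

Lemma convex_function_strongly_convex0 {R : realType} {n} (N : 'rV[R]_n -> R)
    (f : 'rV[R]_n -> R) :
  convex_function setT f -> strongly_convex N 0 f.
Proof.
move=> cf x y s /andP[s0 s1].
have s01 : Itv.spec (@Itv.num_sem R) (Itv.Real `[0, 1]%Z) s.
  by apply/andP; split; [exact: num_real|rewrite in_itv/= s0].
have := cf (Itv.mk s01) x y (mem_set I) (mem_set I).
by rewrite !mul0r subr0.
Qed.

Lemma convex_diff {R : realType} {n} (f : 'rV[R]_n -> R) :
  (forall x, differentiable f x) -> convex_function setT f ->
  forall x y, f y + pairing (grad f y) (x - y) <= f x.
Proof.
move=> df cf x y.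
have /(strongly_convex_diff _ _ _ df)/(_ x y) :=
  convex_function_strongly_convex0 (fun=> 0) f cf.
by rewrite expr0n/= mulr0 addr0.
Qed.

(** Descent lemma. The function
[s |-> f (x + s v) - s <f'(x), v> - s^2 L/2 N(v)^2] has a nonpositive derivative
on [[0, 1]], by the Lipschitz bound on the gradient. *)
Lemma smooth_upper_bound {R : realType} {n} (N : 'rV[R]_n -> R) (f : 'rV[R]_n -> R) L :
  is_norm N -> (forall x, differentiable f x) ->
  (forall u v, dual_norm N (grad f u - grad f v) <= L * N (u - v)) ->
  forall x y, f y <= f x + pairing (grad f x) (y - x) + L / 2 * N (y - x) ^+ 2.
Proof.
move=> NN df Lf x y; set v := y - x; set g := grad f x.
pose c := pairing g v; pose d := L / 2 * N v ^+ 2.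
pose phi (s : R) : R := f (x + s *: v) - (s * c + s ^+ 2 * d).
pose dphi (s : R) : R := 'd f (x + s *: v) v - (c + s * (L * N v ^+ 2)).
have dphiE (s : R) : is_derive s 1 phi (dphi s).
  have dl := is_derive_line f x v s (df _).
  have -> : phi = (fun s : R => f (x + s *: v)) - (c \*: id + d \*: id ^+ 2).
    by apply/funext => u; rewrite /phi [u * c]mulrC [_ * d]mulrC.
  have i1 := is_derive_id s (1 : R).
  have D := is_deriveB dl (is_deriveD (is_deriveZ c i1)
    (is_deriveZ d (is_deriveX 2 i1))).
  apply: is_derive_eq D _.
  rewrite /dphi /GRing.scale/= expr1 /d; lra.
have cphi : {within `[0, 1], continuous phi}.
  apply: continuous_subspaceT => s; apply: differentiable_continuous.
  by apply/derivable1_diffP; have [] := dphiE s.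
have [] := @MVT_segment R phi dphi 0 1 ler01 (fun s _ => dphiE s) cphi.
move=> s /[!in_itv]/= /andP[s0 s1]; rewrite /phi subr0 mulr1.
rewrite scale1r scale0r addr0 [x + v]addrC subrK.
have : dphi s <= 0.
  rewrite /dphi diff_pairing subr_le0 -lerBlDl -pairingBl.
  apply: le_trans (ler_pairing_dual N NN _ _) _.
  have -> : s * (L * N v ^+ 2) = L * (s * N v) * N v by ring.
  apply: ler_wpM2r; first exact: is_norm_ge0.
  apply: le_trans (Lf _ _) _; have [_ NZ _] := NN.
  by rewrite addrC addKr NZ ger0_norm.
rewrite /c /d expr1n; lra.
Qed.

(** * The convex conjugate of a mirror potential *)

(** The linear form on the dual space given by evaluation at [y]; it is the
differential of the conjugate at the image of [y] under the gradient. *)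
Definition pairingr {R : realType} {n} (y : 'rV[R]_n) (p : 'cV[R]_n) : R :=
  pairing p y.

Lemma pairingr_is_linear {R : realType} {n} (y : 'rV[R]_n) :
  linear (pairingr y : 'cV[R]_n -> R).
Proof. by move=> a p q; rewrite /pairingr pairingDl pairingZl. Qed.

HB.instance Definition _ (R : realType) (n : nat) (y : 'rV[R]_n) :=
  GRing.isLinear.Build R 'cV[R]_n R _ (pairingr y) (pairingr_is_linear y).

Lemma pairingr_continuous {R : realType} {n} (y : 'rV[R]_n) :
  continuous (pairingr y : 'cV[R]_n -> R).
Proof.
apply: (@lipschitz_real_continuous _ _ _ (n%:R * `|y|)) => p q.
rewrite /pairingr -pairingBl mulrAC.
exact: le_trans (ler_norm _) (ler_pairing_norm _ _).
Qed.

(** Strong convexity sandwiches the conjugate between its tangent at [grad psi y]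
and that tangent plus a quadratic term, with a constant independent of [y]. *)
Lemma conjugate_bounds {R : realType} {n} (N : 'rV[R]_n -> R) alpha psi :
  is_norm N -> mirror_potential N alpha psi ->
  exists2 C, 0 <= C & forall y q,
    pairing q y - psi y <= conjugate psi q <=
    pairing q y - psi y + C * `|q - grad psi y| ^+ 2.
Proof.
move=> NN [a0 sc dpsi _]; have [K K0 KN] := ler_pairing_is_norm N NN.
exists (K ^+ 2 / (2 * alpha)) => [|y q].
  by rewrite divr_ge0 ?sqr_ge0// mulr_ge0// ltW.
set B := _ + _ * _.
have ubB : ubound [set pairing q x - psi x | x in [set: 'rV[R]_n]] B.
  move=> _ [x _ <-]; rewrite /B.
  have := strongly_convex_diff N alpha psi dpsi sc x y.
  have := KN (q - grad psi y) (x - y).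
  move=> /(le_trans (ler_norm _)); rewrite pairingBl !pairingBr.
  set e := `|q - _|; set w := N (x - y) => h1 h2.
  have : 0 <= alpha / 2 * (w - K * e / alpha) ^+ 2.
    by rewrite mulr_ge0 ?sqr_ge0// divr_ge0// ltW.
  have -> : alpha / 2 * (w - K * e / alpha) ^+ 2 =
     alpha / 2 * w ^+ 2 - K * e * w + K ^+ 2 / (2 * alpha) * e ^+ 2.
    by field; rewrite gt_eqF.
  lra.
apply/andP; split.
  by apply: ub_le_sup; [exists B|exists y].
by apply: ge_sup => //; exists (pairing q y - psi y), y.
Qed.

Lemma conjugate_grad {R : realType} {n} (N : 'rV[R]_n -> R) alpha psi :
  is_norm N -> mirror_potential N alpha psi ->
  forall y, conjugate psi (grad psi y) = pairing (grad psi y) y - psi y.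
Proof.
move=> NN mp y; have [C _ /(_ y (grad psi y))] := conjugate_bounds N alpha psi NN mp.
rewrite subrr normr0 expr0n/= mulr0 addr0 => ?.
by apply/eqP; rewrite eq_le andbC.
Qed.

(** The conjugate is differentiable at every point [grad psi y], with gradient
[y]: the error term in [conjugate_bounds] is quadratic. *)
Lemma diff_conjugate {R : realType} {n} (N : 'rV[R]_n -> R) alpha psi :
  is_norm N -> mirror_potential N alpha psi ->
  forall y v, 'd (conjugate psi) (grad psi y) v = pairing v y.
Proof.
move=> NN mp y v; have [C C0 CB] := conjugate_bounds N alpha psi NN mp.
set p := grad psi y.
suff -> : 'd (conjugate psi) p = pairingr y :> (_ -> _) by [].
apply: diff_unique; first exact: pairingr_continuous.
apply/eqaddoP => _/posnumP[e]; near=> h.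
rewrite !fctE /= /shift /= (conjugate_grad N alpha)// -/p /pairingr.
have := CB y (h + p); rewrite addrK pairingDl => /andP[h1 h2].
rewrite ger0_norm; last lra.
have he : C * `|h| <= e%:num.
  apply: (@le_trans _ _ ((C + 1) * `|h|)); first by rewrite ler_wpM2r//; lra.
  rewrite -ler_pdivlMl; last lra.
  rewrite -[`|h|](normrN) -[- h]add0r.
  near: h; apply: (@pseudometric_normed_Zmodule.cvgr_dist_le R 'cV[R]_n _ (nbhs 0) _ id 0) => //.
  by rewrite mulr_gt0// invr_gt0; lra.
apply: (@le_trans _ _ (C * `|h| * `|h|)); last exact: ler_wpM2r.
rewrite expr2 in h2; lra.
Unshelve. all: by end_near. Qed.

(** The function [psi - p] is coercive by strong convexity, so it attains its
minimum, and there the gradient of [psi] is [p]. *)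
Lemma grad_surjective {R : realType} {n} (N : 'rV[R]_n -> R) alpha psi :
  is_norm N -> mirror_potential N alpha psi ->
  forall p, exists y, grad psi y = p.
Proof.
move=> NN [a0 sc dpsi _] p; have [K K0 KN] := ler_pairing_is_norm N NN.
pose g x := psi x - pairing p x.
set q := grad psi 0 - p.
pose rho := 2 * (K * `|q|) / alpha.
have rho0 : 0 <= rho by rewrite divr_ge0 ?(ltW a0)// !mulr_ge0.
have gout x : rho < N x -> g 0 <= g x.
  move=> rx; rewrite /g pairing0r subr0.
  have := strongly_convex_diff N alpha psi dpsi sc x 0; rewrite subr0.
  have := KN q x; rewrite ler_norml /q pairingBl => /andP[h1 _] h2.
  have : K * `|q| <= alpha / 2 * N x.
    have -> : K * `|q| = alpha / 2 * rho by rewrite /rho; field; rewrite gt_eqF.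
    by rewrite ler_wpM2l ?(ltW rx)// divr_ge0// ltW.
  move=> /(ler_wpM2r (is_norm_ge0 N NN x)); rewrite -/q expr2 in h1 h2 *; lra.
pose S := [set x | N x <= rho].
have S0 : S 0 by rewrite /S/= is_norm0.
have cS : compact S.
  apply: bounded_closed_compact.
    have [L L0 LN] := is_norm_lower N NN.
    exists (L * rho); split=> [|M rM x /= xr]; first exact: num_real.
    by apply: le_trans (LN _) _; apply: le_trans (ltW rM); rewrite ler_pM2l.
  apply: (@closed_comp _ _ N [set z | z <= rho]).
    by move=> x _; exact: is_norm_continuous.
  exact: closed_le.
have cg : {within S, continuous g}.
  apply: continuous_subspaceT => x; apply: (@continuousB R R^o).
    exact: differentiable_continuous.
  apply: (@lipschitz_real_continuous _ _ _ (n%:R * `|p|)) => u v.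
  rewrite -pairingBr; exact: le_trans (ler_norm _) (ler_pairing_norm _ _).
have [y yS ymin] := EVT_min_rV (ex_intro _ 0 S0) cS cg.
have ymin' x : g y <= g x.
  have [xr|xr] := leP (N x) rho; first by apply: ymin; rewrite inE.
  by apply: le_trans (gout _ xr); apply: ymin; rewrite inE.
exists y.
have ge v : pairing p v <= pairing (grad psi y) v.
  rewrite -diff_pairing; apply: (@diff_ge_of_line _ _ _ _ _ _ 0) => // s _.
  have := ymin' (y + s *: v); rewrite /g pairingDr pairingZr; lra.
apply/matrixP => i j; rewrite ord1 -!pairing_delta; apply/eqP.
rewrite eq_le ge andbT.
have := ge (- delta_mx 0 i); rewrite -scaleN1r !pairingZr; lra.
Qed.

Lemma grad_invK {R : realType} {n} (N : 'rV[R]_n -> R) alpha psi :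
  is_norm N -> mirror_potential N alpha psi ->
  forall p, grad psi (grad_inv psi p) = p.
Proof.
move=> NN mp p; apply: pinvK; rewrite inE.
by have [y yp] := grad_surjective N alpha psi NN mp p; exists y.
Qed.

(** * One step of mirror descent and one regularized gradient step *)

Lemma dual_normZ_le {R : realType} {n} (N : 'rV[R]_n -> R) : is_norm N ->
  forall a p, dual_norm N (a *: p) <= `|a| * dual_norm N p.
Proof.
move=> NN a p; apply: dual_norm_le => // x x1; have [_ NZ _] := NN.
rewrite pairingZl -pairingZr; apply: le_trans (ler_pairing_dual N NN _ _) _.
rewrite NZ mulrCA ler_wpM2l// ler_piMr//; exact: dual_norm_ge0.
Qed.

Lemma dual_normZ {R : realType} {n} (N : 'rV[R]_n -> R) : is_norm N ->
  forall a p, dual_norm N (a *: p) = `|a| * dual_norm N p.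
Proof.
move=> NN a p; apply/eqP; rewrite eq_le dual_normZ_le//=.
have [->|a0] := eqVneq a 0; first by rewrite normr0 mul0r dual_norm_ge0.
rewrite -ler_pdivlMl ?normr_gt0// -normfV.
by apply: le_trans (dual_normZ_le N NN _ _); rewrite scalerA mulVf// scale1r.
Qed.

Lemma bregman_ge0 {R : realType} {n} (N : 'rV[R]_n -> R) alpha psi :
  mirror_potential N alpha psi -> forall x y, 0 <= bregman psi x y.
Proof.
move=> [a0 sc dpsi _] x y; rewrite /bregman diff_pairing.
have := strongly_convex_diff N alpha psi dpsi sc x y.
have : 0 <= alpha / 2 * N (x - y) ^+ 2.
  by rewrite mulr_ge0 ?sqr_ge0// divr_ge0// ltW.
lra.
Qed.

(** Change of the divergence to a reference point [xs] over one step. Here [zh]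
is the exact mirror step from [z], while [zp] is arbitrary and contributes only
the last term. Smoothness of the conjugate enters because
[bregman (conjugate psi) (grad psi zh) (grad psi z)] is exactly
[- bregman psi zh z - <a g, zh - z>]. *)
Lemma mirror_step {R : realType} {n} (N : 'rV[R]_n -> R) alpha psi L :
  is_norm N -> mirror_potential N alpha psi ->
  (forall p q, bregman (conjugate psi) p q <= L / 2 * dual_norm N (p - q) ^+ 2) ->
  forall (xs z zh zp : 'rV[R]_n) g a,
  grad psi zh = grad psi z - a *: g ->
  bregman psi xs zp <= bregman psi xs z - a * pairing g (z - xs)
    + L / 2 * (a ^+ 2 * dual_norm N g ^+ 2)
    + pairing (grad psi zp - grad psi zh) (zp - xs).
Proof.
move=> NN mp Lp xs z zh zp g a.
have bE x y : bregman psi x y = psi x - psi y - pairing (grad psi y) (x - y).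
  by rewrite /bregman diff_pairing.
have cE := conjugate_grad N alpha psi NN mp.
have bcE q y : bregman (conjugate psi) q (grad psi y) =
    conjugate psi q - conjugate psi (grad psi y) - pairing (q - grad psi y) y.
  by congr (_ - _); exact: (diff_conjugate N alpha).
have b0 := bregman_ge0 N alpha psi mp zp zh.
(* The rest is bilinear algebra from these identities, valid for any functions in
   place of the divergences, the conjugate and the gradient. *)
move: (bregman psi) (bregman (conjugate psi)) bE bcE b0 Lp => B Bc bE bcE b0 Lp.
move: (conjugate psi) (grad psi) cE bcE bE => cf G cE bcE bE zhE.
move: b0 (Lp (G zh) (G z)); rewrite bcE !bE !cE zhE.
have -> : G z - a *: g - G z = (- a) *: g.
  by rewrite addrAC subrr add0r scaleNr.
rewrite dual_normZ// normrN exprMn real_normK ?num_real//.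
rewrite !(pairingBr, pairingBl, pairingZl); lra.
Qed.

(** The minimizer [y] of the regularized linear model decreases [f] by a multiple
of the squared dual norm of the gradient. No maximizer of the pairing on the
unit ball is needed: the estimate is shown for each [v] with [N v <= 1] by testing
the minimality of [y] against a step along [v], and the supremum is taken last. *)
Lemma regularized_step {R : realType} {n} (N : 'rV[R]_n -> R) f L lR LR s
    (Reg : 'rV[R]_n -> 'rV[R]_n -> R) x y :
  is_norm N -> (forall x, differentiable f x) ->
  (forall u v, dual_norm N (grad f u - grad f v) <= L * N (u - v)) ->
  0 < s -> 0 < LR -> s * L <= lR ->
  (forall u v, lR / 2 * N (u - v) ^+ 2 <= Reg u v <= LR / 2 * N (u - v) ^+ 2) ->
  argmin (fun u => s * pairing (grad f x) u + Reg u x) y ->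
  s / (2 * LR) * dual_norm N (grad f x) ^+ 2 <= f x - f y.
Proof.
move=> NN df Lf s0 LR0 sL Rb ymin; set g := grad f x.
have [_ NZ _] := NN.
have key v : N v <= 1 -> pairing g v ^+ 2 <= (f x - f y) / (s / (2 * LR)).
  move=> v1; rewrite ler_pdivlMr ?divr_gt0 ?mulr_gt0// -(ler_pM2l s0).
  (* This step length minimizes s <g, - tau v> + LR / 2 tau^2 over tau. *)
  set c := pairing g v.
  have := ymin (x - (s * c / LR) *: v).
  have /andP[_] := Rb (x - (s * c / LR) *: v) x.
  have /andP[] := Rb y x.
  rewrite [x - _]addrC addrK -scaleNr NZ pairingDr pairingZr -/g -/c => h1 _ h2 h3.
  have h4 := smooth_upper_bound N f L NN df Lf x y.
  rewrite -/g pairingBr in h4.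
  have {}h2 : Reg (- (s * c / LR) *: v + x) x <= LR / 2 * (s * c / LR) ^+ 2.
    apply: le_trans h2 _; rewrite ler_wpM2l ?divr_ge0 ?(ltW LR0)//.
    rewrite exprMn real_normK ?num_real// sqrrN ler_piMr ?sqr_ge0//.
    by rewrite expr_le1// is_norm_ge0.
  have {}h4 := ler_wpM2l (ltW s0) h4.
  have h5 : s * L / 2 * N (y - x) ^+ 2 <= lR / 2 * N (y - x) ^+ 2.
    by rewrite ler_wpM2r ?sqr_ge0// ler_wpM2r.
  have E1 : LR / 2 * (s * c / LR) ^+ 2 = s * (c ^+ 2 * (s / (2 * LR))).
    by field; rewrite gt_eqF.
  have E2 : s * (s * c / LR * c) = 2 * (s * (c ^+ 2 * (s / (2 * LR)))).
    by field; rewrite gt_eqF.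
  set w := N (y - x) in h1 h4 h5; lra.
have Y0 : 0 <= (f x - f y) / (s / (2 * LR)).
  by apply: le_trans (sqr_ge0 _) (key 0 _); rewrite is_norm0.
rewrite mulrC -ler_pdivlMr ?divr_gt0 ?mulr_gt0//.
rewrite -[leRHS]sqr_sqrtr// lerXn2r ?nnegrE ?sqrtr_ge0 ?dual_norm_ge0//.
apply: dual_norm_le => // v /key gv.
by apply: le_trans (ler_norm _) _; rewrite -sqrtr_sqr ler_sqrt.
Qed.

(** * The energy estimate and the convergence rate *)

(** One iteration, from the pair [(z, y)] to [(z', y')] through the point [x']:
the energy grows by at most [M], except that the weight [k^2] of the old value
gap is replaced by [k (k + r)]. *)
Lemma amd_energy_step {R : realType} {n} (N f : 'rV[R]_n -> R) (Lf : R) xs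
    psi alpha Reg r gamma Lpsi lR LR M t k (x' z y zh z' y' : 'rV[R]_n) :
  is_norm N -> convex_function setT f -> (forall u, differentiable f u) ->
  0 < Lf ->
  (forall u v, dual_norm N (grad f u - grad f v) <= Lf * N (u - v)) ->
  argmin f xs -> mirror_potential N alpha psi -> 0 < r -> 0 < gamma -> 0 < t ->
  0 <= k ->
  (forall p q, bregman (conjugate psi) p q <= Lpsi / 2 * dual_norm N (p - q) ^+ 2) ->
  0 < LR ->
  (forall u v, lR / 2 * N (u - v) ^+ 2 <= Reg u v <= LR / 2 * N (u - v) ^+ 2) ->
  LR * Lpsi <= gamma -> t <= lR / (Lf * gamma) ->
  x' = r / (r + k) *: z + (1 - r / (r + k)) *: y ->
  grad psi zh = grad psi z - (k * t / r) *: grad f x' ->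
  argmin (fun u => gamma * t * pairing (grad f x') u + Reg u x') y' ->
  pairing (grad psi z' - grad psi zh) (z' - xs) <= M ->
  bregman psi xs z' + k * (k + r) * t / r ^+ 2 * (f y' - f xs) <=
  bregman psi xs z + k ^+ 2 * t / r ^+ 2 * (f y - f xs) + M.
Proof.
move=> NN cf df Lf0 Lfs xsmin mp r0 g0 t0 k0 Lp LR0 Rb gL tL x'E zhE ymin errM.
have step := mirror_step N alpha psi Lpsi NN mp Lp xs z zh z' _ _ zhE.
move: (bregman psi) step => B step.
have s0 : 0 < gamma * t by rewrite mulr_gt0.
have sL : gamma * t * Lf <= lR.
  move: tL; rewrite ler_pdivlMr ?mulr_gt0//.
  by have -> : gamma * t * Lf = t * (Lf * gamma) by ring.
have dec := regularized_step N f Lf lR LR (gamma * t) Reg x' y' NN df Lfs s0 LR0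
  sL Rb ymin.
set D2 := dual_norm N (grad f x') ^+ 2 in step dec.
have D20 : 0 <= D2 by exact: sqr_ge0.
(* The constant of the decrease of f is gamma / (2 LR) >= Lpsi / 2. *)
have dec' : Lpsi / 2 * (t * D2) <= f x' - f y'.
  apply: le_trans dec.
  have -> : gamma * t / (2 * LR) * D2 = gamma / LR / 2 * (t * D2).
    by field; rewrite gt_eqF.
  apply: ler_wpM2r; first by rewrite mulr_ge0 ?(ltW t0).
  by apply: ler_wpM2r => //; rewrite ler_pdivlMr// mulrC.
have fy' : f y' <= f x'.
  rewrite -subr_ge0; apply: le_trans dec.
  by rewrite mulr_ge0// divr_ge0 ?mulr_ge0 ?ltW.
have rk0 : r + k != 0 by rewrite gt_eqF// ltr_pwDl.
(* x' is a convex combination of z and y. *)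
have xz : r *: (z - x') = k *: (x' - y).
  rewrite x'E; apply/matrixP => i j; rewrite !mxE; field.
  by rewrite gt_eqF// ltr_pwDl.
have c1 := convex_diff f df cf xs x'.
have c2 := convex_diff f df cf y x'.
(* The two gradient inequalities at x', towards xs and towards y. *)
have pz : r * pairing (grad f x') (z - xs) >=
    r * (f x' - f xs) + k * (f x' - f y).
  have : r * pairing (grad f x') (z - x') = k * pairing (grad f x') (x' - y).
    by rewrite -!pairingZr xz.
  rewrite !pairingBr in c1 c2 *.
  have := ler_wpM2l (ltW r0) c1; have := ler_wpM2l k0 c2; lra.
have a0 : 0 <= k * t / r ^+ 2.
  by rewrite divr_ge0 ?sqr_ge0 ?mulr_ge0 ?(ltW t0).
have b0 : 0 <= k ^+ 2 * t / r ^+ 2.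
  by rewrite divr_ge0 ?sqr_ge0 ?mulr_ge0 ?sqr_ge0 ?(ltW t0).
have e0 : 0 <= k * t / r by rewrite divr_ge0 ?mulr_ge0 ?(ltW t0) ?(ltW r0).
have h1 := ler_wpM2l a0 pz.
have h2 := ler_wpM2l b0 dec'.
have h3 := ler_wpM2l e0 fy'.
have r0' : r != 0 by rewrite gt_eqF.
have E1 : k * t / r ^+ 2 * (r * pairing (grad f x') (z - xs)) =
  k * t / r * pairing (grad f x') (z - xs) by field.
have E2 : Lpsi / 2 * ((k * t / r) ^+ 2 * D2) =
  k ^+ 2 * t / r ^+ 2 * (Lpsi / 2 * (t * D2)) by field.
have E3 : k * t / r ^+ 2 * (r * (f x' - f xs) + k * (f x' - f y)) =
  k * t / r * (f x' - f xs) + k ^+ 2 * t / r ^+ 2 * (f x' - f y) by field.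
have E4 : k * (k + r) * t / r ^+ 2 = k ^+ 2 * t / r ^+ 2 + k * t / r by field.
rewrite E4; lra.
Qed.

Theorem theorem1 (R : realType) (n : nat) (N : 'rV[R]_n -> R)
    (f : 'rV[R]_n -> R) (Lf : R) (xstar : 'rV[R]_n)
    (psi : 'rV[R]_n -> R) (alpha : R) (Mstar : 'cV[R]_n -> R)
    (Reg : 'rV[R]_n -> 'rV[R]_n -> R)
    (r gamma Lpsi lR LR M c : R) (t : nat -> R)
    (x xt zt zh : nat -> 'rV[R]_n)
    (N_norm : is_norm N)
    (f_convex : convex_function setT f)
    (f_diff : forall u, differentiable f u)
    (Lf_gt0 : 0 < Lf)
    (f_smooth : forall u v, dual_norm N (grad f u - grad f v) <= Lf * N (u - v))
    (xstar_min : argmin f xstar)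
    (psi_mirror : mirror_potential N alpha psi)
    (Mstar_diff : forall p, differentiable Mstar p)
    (r_ge3 : 3 <= r)
    (gamma_gt0 : 0 < gamma)
    (t_gt0 : forall k, 0 < t k)
    (amd : approx_amd f psi Mstar Reg r gamma t x xt zt)
    (md : exact_md f psi r t x zt zh)
    (psi_conj_smooth : forall p q : 'cV[R]_n,
       bregman (conjugate psi) p q <= Lpsi / 2 * dual_norm N (p - q) ^+ 2)
    (lR_gt0 : 0 < lR)
    (lR_le_LR : lR <= LR)
    (Reg_bounds : forall u v,
       lR / 2 * N (u - v) ^+ 2 <= Reg u v <= LR / 2 * N (u - v) ^+ 2)
    (gamma_ge : LR * Lpsi <= gamma)
    (t_le : forall k, t k <= lR / (Lf * gamma))
    (t_noninc : forall k, t k.+1 <= t k)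
    (M_gt0 : 0 < M)
    (err_le : forall k,
       pairing (grad psi (zt k.+1) - grad psi (zh k.+1)) (zt k.+1 - xstar) <= M)
    (c_range : 0 <= c < 1)
    (t_Theta : t =Theta_\oo (fun k => k%:R `^ (- c))) :
  (fun k => f (xt k) - f xstar) =O_\oo (fun k => k%:R `^ (c - 1)).
Proof.
have LR0 : 0 < LR by exact: lt_le_trans lR_le_LR.
have r0 : 0 < r by apply: lt_le_trans r_ge3.
have [_ _ xE _ xtmin] := amd.
pose F k := f (xt k) - f xstar.
pose D k := bregman psi xstar (zt k).
have F0 k : 0 <= F k by rewrite subr_ge0; exact: xstar_min.
have D0 k : 0 <= D k by exact: (bregman_ge0 N alpha).
have zhE k : grad psi (zh k.+1) = grad psi (zt k) - (k%:R * t k / r) *: grad f (x k.+1).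
  by rewrite md (grad_invK N alpha).
have step k : D k.+1 + k%:R * (k%:R + r) * t k / r ^+ 2 * F k.+1 <=
    D k + k%:R ^+ 2 * t k / r ^+ 2 * F k + M.
  exact: (amd_energy_step N f Lf xstar psi alpha Reg r gamma Lpsi lR LR M (t k)
    k%:R _ (zt k) (xt k) (zh k.+1)  _ _ N_norm f_convex f_diff Lf_gt0 f_smooth
    xstar_min psi_mirror r0 gamma_gt0 (t_gt0 k) (ler0n _ _) psi_conj_smooth LR0
    Reg_bounds gamma_ge (t_le k) (xE k) (zhE k) (xtmin k) (err_le k)).
pose E k := D k + k%:R ^+ 2 * t k / r ^+ 2 * F k.
have E0 k : 0 <= E k.
  by rewrite addr_ge0// mulr_ge0// divr_ge0 ?sqr_ge0// mulr_ge0 ?sqr_ge0// ltW.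
(* Since r >= 3, (k + 1)^2 <= k (k + r) for k >= 1; this fails for k = 0, so the
   telescoping starts at k = 1. *)
have Estep k : (0 < k)%N -> E k.+1 <= E k + M.
  move=> k0; apply: le_trans (step k); rewrite lerD2l ler_wpM2r//.
  rewrite ler_wpM2r ?invr_ge0 ?sqr_ge0//; apply: ler_pM; rewrite ?sqr_ge0 ?(ltW (t_gt0 _))//.
  have k1 : 1 <= k%:R :> R by rewrite ler1n.
  rewrite -natr1; nra.
have Ebound k : (0 < k)%N -> E k <= E 1%N + k%:R * M.
  elim: k => // -[_ _|k IH _]; first by rewrite mul1r lerDl ltW.
  apply: le_trans (Estep _ _) _ => //; rewrite -natr1 mulrDl mul1r.
  have := IH isT; lra.
pose C := r ^+ 2 * (E 1%N + M).
have Fbound k : (0 < k)%N -> k%:R * t k * F k <= C.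
  move=> k0; have k1 : 1 <= k%:R :> R by rewrite ler1n.
  have kp : 0 < k%:R :> R by exact: lt_le_trans k1.
  have : k%:R ^+ 2 * t k / r ^+ 2 * F k <= k%:R * (E 1%N + M).
    apply: (@le_trans _ _ (E k)); first by rewrite lerDr.
    apply: le_trans (Ebound k k0) _; rewrite mulrDr lerD2r.
    by rewrite ler_peMl.
  have -> : k%:R ^+ 2 * t k / r ^+ 2 * F k =
     k%:R * ((k%:R * t k * F k) / r ^+ 2) by field; rewrite gt_eqF.
  by rewrite ler_pM2l// ler_pdivrMr ?exprn_gt0// /C [r ^+ 2 * _]mulrC.
have /asboolP[[a b] /= /andP[a0 _] tlow] : t \is 'Theta_\oo (fun k => (k%:R : R) `^ (- c)).
  by rewrite -eqThetaE.
apply/eqO_exP; exists (C / a).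
  by rewrite divr_gt0// mulr_gt0 ?exprn_gt0// ltr_wpDl.
near=> k.
have k0 : (0 < k)%N by near: k; exact: nbhs_infty_gt.
have kp : 0 < k%:R :> R by rewrite ltr0n.
have [+ _] : a * `|k%:R `^ (- c)| <= `|t k| /\ `|t k| <= b * `|k%:R `^ (- c)|.
  by near: k.
rewrite !ger0_norm ?powR_ge0 ?F0 ?(ltW (t_gt0 k))// => tk.
have powE : k%:R `^ (c - 1) = (k%:R * k%:R `^ (- c))^-1 :> R.
  rewrite invfM -powRN opprK mulrC powRD; last by rewrite (gt_eqF kp) implybT.
  by rewrite powR_inv1// ltW.
have pc : 0 < k%:R `^ (- c) :> R by exact: powR_gt0.
rewrite powE -mulrA -invfM ler_pdivlMr ?mulr_gt0//.
apply: le_trans (Fbound k k0); rewrite mulrC -/(F k) ler_wpM2r//.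
by rewrite mulrCA ler_wpM2l// ltW.
Unshelve. all: by end_near. Qed.
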